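(* Suppose that the Hamiltonians $H:T^*Q\to\mathbb{R}$ and $h:T^*Q\to\mathbb{R}$ are invariant with respect to the cotangent lift action $\Phi^{T^*Q}:G\times T^*Q\to T^*Q$ of the Lie group $G$, that is, $$H\circ\Phi^{T^*Q}_g=H,\qquad h\circ\Phi^{T^*Q}_g=h\qquad\text{for all }g\in G,$$ and suppose the interpolating polynomial $q_d(t;q^\mu)$ is equivariant with respect to $G$, that is, for all $g\in G$, $$\Phi^{TQ}_g\Big(q_d(t;q^\mu),\dot q_d(t;q^\mu)\Big)=\Big(q_d\big(t;\Phi_g(q^\mu)\big),\dot q_d\big(t;\Phi_g(q^\mu)\big)\Big).$$ Let $H^+_d$ be the stochastic discrete Hamiltonian defined in the context. Then the generalized discrete stochastic Lagrangian $$R_d(q_k,p_{k+1})=p_{k+1}q_{k+1}-H^+_d(q_k,p_{k+1}),\qquad\text{where }q_{k+1}=D_2H^+_d(q_k,p_{k+1}),$$ is invariant with respect to the action of $G$, that is, $$R_d\big(\Phi_g(q_k),\ \pi_{Q^*}\circ\Phi^{T^*Q}_g(q_{k+1},p_{k+1})\big)=R_d(q_k,p_{k+1})\qquad\text{for all }g\in G,$$ where $\pi_{Q^*}:Q\times Q^*\to Q^*$ is the projection onto $Q^*$.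
   Context: $Q\cong\mathbb{R}^N$, $TQ=Q\times Q$, $T^*Q=Q\times Q^*\cong\mathbb{R}^N\times\mathbb{R}^N$ with canonical coordinates $(q,p)$; products such as $p\,q$ denote the scalar product. $W(t)$ is a standard one-dimensional Wiener process on a filtered probability space $(\Omega,\mathcal{F},\mathbb{P})$; $t_k=k\Delta t$, $\Delta t>0$, and $\Delta W=W(t_{k+1})-W(t_k)$. The Hamiltonians $H,h$ (time-independent) are $C^2$, and the coefficients $A,B$ of the It\^o form $dz=A(z)dt+B(z)dW(t)$, $z=(q,p)$, of the stochastic Hamiltonian system $dq=\frac{\partial H}{\partial p}dt+\frac{\partial h}{\partial p}\circ dW(t)$, $dp=-\frac{\partial H}{\partial q}dt-\frac{\partial h}{\partial q}\circ dW(t)$ (with $\circ$ denoting Stratonovich integration) are globally Lipschitz. Group actions: the Lie group $G$ acts on $Q$ by a left action $\Phi:G\times Q\to Q$, $\Phi_g(q)=\Phi(g,q)$. The tangent and cotangent lift actions are, in coordinates (summation over repeated indices), $$\Phi^{TQ}_g(q,\dot q)=\Big(\Phi^i_g(q),\frac{\partial\Phi^i_g}{\partial q^j}(q)\,\dot q^j\Big),\qquad\Phi^{T^*Q}_g(q,p)=\Big(\Phi^i_g(q),\,p_j\frac{\partial\Phi^j_{g^{-1}}}{\partial q^i}\big(\Phi_g(q)\big)\Big).$$ Discretization: let $s\ge1$, control points $0=d_0<d_1<\dots<d_s=1$, and let $l_{\mu,s}(\tau)$ be the corresponding Lagrange polynomials of degree $s$, $l_{\mu,s}(d_\nu)=\delta_{\mu\nu}$.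 For control values $q^0,\dots,q^s\in Q$ (collectively denoted $q^\mu$) put $$q_d(t_k+\tau\Delta t;q^\mu)=\sum_{\mu=0}^sq^\mu l_{\mu,s}(\tau),\qquad \dot q_d(t_k+\tau\Delta t;q^\mu)=\frac1{\Delta t}\sum_{\mu=0}^sq^\mu\dot l_{\mu,s}(\tau).$$ Let $(\alpha_i,c_i)_{i=1}^r$ and $(\beta_i,c_i)_{i=1}^r$ be quadrature rules with points $0\le c_1<\dots<c_r\le1$ and weights $\alpha_i$, $\beta_i$, where for each $i$ we have $\alpha_i\ne0$ or $\beta_i\ne0$. The discrete Hamiltonian is $$H^+_d(q_k,p_{k+1})=\mathop{\mathrm{ext}}_{\substack{q^1,\dots,q^s\in Q \\ P_1,\dots,P_r\in Q^* \\ q^0=q_k}}\Big\{p_{k+1}q^s-\Delta t\sum_{i=1}^r\alpha_i\big[P_i\,\dot q_d(t_k+c_i\Delta t)-H\big(q_d(t_k+c_i\Delta t),P_i\big)\big]+\Delta W\sum_{i=1}^r\beta_i\,h\big(q_d(t_k+c_i\Delta t),P_i\big)\Big\},$$ where $\mathrm{ext}$ denotes the extremal (stationary) value with respect to the indicated variables, taken pointwise in $\Omega$. $D_2$ denotes the derivative with respect to the second argument. *)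

(* Defs.v *)
From HB Require Import structures.
From mathcomp Require Export all_boot all_order all_algebra.
From mathcomp Require Export all_classical all_reals all_analysis.

Set Implicit Arguments.
Unset Strict Implicit.
Unset Printing Implicit Defensive.

Import Order.TTheory GRing.Theory Num.Theory.
Export numFieldNormedType.Exports.

Local Open Scope classical_set_scope.
Local Open Scope ring_scope.

(* Positions in [Q] = R^N and covectors in [Q^*] are both row vectors. *)

Definition dot (R : realType) (n : nat) (u v : 'rV[R]_n) : R :=
  \sum_(i < n) u 0 i * v 0 i.

Definition pderiv (R : realType) (n : nat) (W : normedModType R)
    (i : 'I_n) (f : 'rV[R]_n -> W) (x : 'rV[R]_n) : W :=
  'D_(delta_mx 0 i) f x.

Definition grad (R : realType) (n : nat) (f : 'rV[R]_n -> R) (x : 'rV[R]_n) :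
    'rV[R]_n :=
  \row_i pderiv i f x.

(* [f] is of class C^k on [U]: meant for [U] open and [V] finite dimensional,
   where it amounts to continuity of all partial derivatives up to order [k]. *)
Fixpoint Ck_on (R : realType) (V W : normedModType R) (k : nat) (U : set V)
    (f : V -> W) {struct k} : Prop :=
  if k is k'.+1 then
    (forall x, U x -> differentiable f x) /\
    (forall v, Ck_on k' U (fun x => 'D_v f x))
  else forall x, U x -> {for x, continuous f}.

Definition smooth_on (R : realType) (V W : normedModType R) (U : set V)
    (f : V -> W) : Prop :=
  forall k, Ck_on k U f.

#[short(type="groupTopologicalType")]
HB.structure Definition GroupTopological := {G of Group G & Topological G}.

(* A homeomorphism [cmap], with inverse [cinv], from the open set [cdom] onto
   the open set [cimg] of R^m; the values outside these sets are irrelevant. *)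
Record chart (R : realType) (m : nat) (G : topologicalType) := Chart {
  cdom : set G;
  cmap : G -> 'rV[R]_m;
  cinv : 'rV[R]_m -> G;
  cimg : set 'rV[R]_m := cmap @` cdom;
  cdom_open : open cdom;
  cimg_open : open cimg;
  cmapK : forall x, cdom x -> cinv (cmap x) = x;
  cmap_continuous : forall x, cdom x -> {for x, continuous cmap};
  cinv_continuous : forall z, cimg z -> {for z, continuous cinv}
}.

Record is_lie_group (R : realType) (m : nat) (G : groupTopologicalType)
    (atlas : set (chart R m G)) : Prop := IsLieGroup {
  lie_hausdorff : hausdorff_space G;
  lie_second_countable : @second_countable G;
  lie_cover : forall x : G, exists2 a, atlas a & cdom a x;
  lie_compatible : forall a b, atlas a -> atlas b ->
    smooth_on (cmap a @` (cdom a `&` cdom b)) (cmap b \o cinv a);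
  lie_mul_continuous : continuous (fun x : G * G => (x.1 * x.2)%g);
  lie_mul_smooth : forall a b c, atlas a -> atlas b -> atlas c ->
    smooth_on
      [set z : 'rV[R]_m * 'rV[R]_m |
        [/\ cimg a z.1, cimg b z.2 & cdom c (cinv a z.1 * cinv b z.2)%g]]
      (fun z => cmap c (cinv a z.1 * cinv b z.2)%g);
  lie_inv_continuous : continuous (fun x : G => (x^-1)%g);
  lie_inv_smooth : forall a b, atlas a -> atlas b ->
    smooth_on [set z : 'rV[R]_m | cimg a z /\ cdom b ((cinv a z)^-1)%g]
      (fun z => cmap b ((cinv a z)^-1)%g)
}.

Record is_lie_left_action (R : realType) (m N : nat) (G : groupTopologicalType)
    (atlas : set (chart R m G)) (Phi : G -> 'rV[R]_N -> 'rV[R]_N) : Prop :=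
  IsLieLeftAction {
  act1 : forall q, Phi 1%g q = q;
  actM : forall g h q, Phi (g * h)%g q = Phi g (Phi h q);
  act_smooth : forall a, atlas a ->
    smooth_on [set z : 'rV[R]_m * 'rV[R]_N | cimg a z.1]
      (fun z => Phi (cinv a z.1) z.2)
}.

Definition tangent_lift (R : realType) (N : nat) (G : groupType)
    (Phi : G -> 'rV[R]_N -> 'rV[R]_N) (g : G) (z : 'rV[R]_N * 'rV[R]_N) :
    'rV[R]_N * 'rV[R]_N :=
  (Phi g z.1, \row_i \sum_(j < N) pderiv j (Phi g) z.1 0 i * z.2 0 j).

Definition cotangent_lift (R : realType) (N : nat) (G : groupType)
    (Phi : G -> 'rV[R]_N -> 'rV[R]_N) (g : G) (z : 'rV[R]_N * 'rV[R]_N) :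
    'rV[R]_N * 'rV[R]_N :=
  (Phi g z.1,
   \row_i \sum_(j < N) z.2 0 j * pderiv i (Phi (g^-1)%g) (Phi g z.1) 0 j).

(* Time is [0, +oo[: in a filtration or a process indexed by [R], the values at
   negative times are irrelevant. *)

Definition is_filtration (R : realType) (d : measure_display)
    (Omega : measurableType d) (F : R -> set (set Omega)) : Prop :=
  (forall t, 0 <= t -> sigma_algebra setT (F t) /\ F t `<=` measurable) /\
  (forall s t, 0 <= s -> s <= t -> F s `<=` F t).

Record is_wiener (R : realType) (d : measure_display)
    (Omega : measurableType d) (P : probability Omega R)
    (F : R -> set (set Omega)) (W : R -> Omega -> R) : Prop := IsWiener {
  wiener_adapted : forall t, 0 <= t ->
    forall B : set R, measurable B -> F t (W t @^-1` B);
  wiener_start : {ae P, forall w, W 0 w = 0};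
  wiener_indep : forall s t, 0 <= s -> s < t ->
    forall (A : set Omega) (B : set R), F s A -> measurable B ->
    P (A `&` (W t \- W s)%R @^-1` B) = (P A * P ((W t \- W s)%R @^-1` B))%E;
  (* the second parameter of [normal_prob] is the standard deviation *)
  wiener_gauss : forall s t, 0 <= s -> s < t ->
    forall B : set R, measurable B ->
    P ((W t \- W s)%R @^-1` B) = normal_prob 0 (Num.sqrt (t - s)) B;
  wiener_continuous :
    {ae P, forall w, {within `[0, +oo[, continuous (fun t => W t w)}}
}.

Definition ham_field (R : realType) (N : nat)
    (H : 'rV[R]_N * 'rV[R]_N -> R) (z : 'rV[R]_N * 'rV[R]_N) :
    'rV[R]_N * 'rV[R]_N :=
  (grad (fun p => H (z.1, p)) z.2, - grad (fun q => H (q, z.2)) z.1).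

Definition ito_diffusion (R : realType) (N : nat)
    (h : 'rV[R]_N * 'rV[R]_N -> R) : 'rV[R]_N * 'rV[R]_N -> 'rV[R]_N * 'rV[R]_N :=
  ham_field h.

(* The Ito drift is the Stratonovich drift plus the correction (1/2) DB(z)B(z),
   written with the derivative of [B] at [z] in the direction [B z]. *)
Definition ito_drift (R : realType) (N : nat)
    (H h : 'rV[R]_N * 'rV[R]_N -> R) (z : 'rV[R]_N * 'rV[R]_N) :
    'rV[R]_N * 'rV[R]_N :=
  ham_field H z + 2^-1 *: 'D_(ito_diffusion h z) (ito_diffusion h) z.

Record galerkin (R : realType) (s r : nat) := Galerkin {
  cpt : 'I_s.+1 -> R;
  cpt0 : cpt ord0 = 0;
  cpt1 : cpt ord_max = 1;
  cpt_inc : forall i j : 'I_s.+1, (i < j)%N -> cpt i < cpt j;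
  qpt : 'I_r -> R;
  qpt_ge0 : forall i, 0 <= qpt i;
  qpt_le1 : forall i, qpt i <= 1;
  qpt_inc : forall i j : 'I_r, (i < j)%N -> qpt i < qpt j;
  alpha : 'I_r -> R;
  beta : 'I_r -> R;
  weight_neq0 : forall i, alpha i != 0 \/ beta i != 0
}.

Definition time (R : realType) (dt : R) (k : nat) : R := k%:R * dt.

Definition lagrange_poly (R : realType) (s r : nat) (S : galerkin R s r)
    (mu : 'I_s.+1) : {poly R} :=
  \prod_(nu < s.+1 | nu != mu)
    ((cpt S mu - cpt S nu)^-1 *: ('X - (cpt S nu)%:P)).

(* The control values q^0, ..., q^s are the rows of [q]. *)
Definition qd (R : realType) (N s r : nat) (S : galerkin R s r) (dt : R)
    (k : nat) (t : R) (q : 'M[R]_(s.+1, N)) : 'rV[R]_N :=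
  \sum_(mu < s.+1)
    (lagrange_poly S mu).[(t - time dt k) / dt] *: row mu q.

Definition dot_qd (R : realType) (N s r : nat) (S : galerkin R s r) (dt : R)
    (k : nat) (t : R) (q : 'M[R]_(s.+1, N)) : 'rV[R]_N :=
  dt^-1 *: \sum_(mu < s.+1)
    ((lagrange_poly S mu)^`()).[(t - time dt k) / dt] *: row mu q.

Definition map_rows (R : realType) (s N : nat) (f : 'rV[R]_N -> 'rV[R]_N)
    (q : 'M[R]_(s.+1, N)) : 'M[R]_(s.+1, N) :=
  \matrix_(mu < s.+1) f (row mu q).

Definition equivariant_interpolation (R : realType) (N s r : nat)
    (S : galerkin R s r) (dt : R) (k : nat) (G : groupType)
    (Phi : G -> 'rV[R]_N -> 'rV[R]_N) : Prop :=
  forall (g : G) (q : 'M[R]_(s.+1, N)) (t : R),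
    time dt k <= t <= time dt k.+1 ->
    tangent_lift Phi g (qd S dt k t q, dot_qd S dt k t q) =
    (qd S dt k t (map_rows (Phi g) q), dot_qd S dt k t (map_rows (Phi g) q)).

Definition stationary_value (R : realType) (V : normedModType R)
    (F : V -> R) (v : R) : Prop :=
  exists y : V, [/\ differentiable F y, (forall u, 'd F y u = 0) & F y = v].

(* [ext F] denotes "the" stationary value of [F]; it is meaningful only under
   [ext_defined F], as [get] returns an unspecified element of the set. *)
Definition ext (R : realType) (V : normedModType R) (F : V -> R) : R :=
  get [set v | stationary_value F v].

Definition ext_defined (R : realType) (V : normedModType R) (F : V -> R) :
    Prop :=
  exists! v, stationary_value F v.

Definition increment (R : realType) (Omega : Type) (W : R -> Omega -> R)
    (dt : R) (k : nat) (w : Omega) : R :=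
  W (time dt k.+1) w - W (time dt k) w.

(* The expression between braces in H_d^+(q_k, p_{k+1}), as a function of the
   rows q^1, ..., q^s of [y.1] and of the rows P_1, ..., P_r of [y.2];
   [dW] is the realized value of the Wiener increment. *)
Definition discrete_functional (R : realType) (N s r : nat)
    (S : galerkin R s r) (dt : R) (k : nat) (H h : 'rV[R]_N * 'rV[R]_N -> R)
    (dW : R) (q0 p1 : 'rV[R]_N) (y : 'M[R]_(s, N) * 'M[R]_(r, N)) : R :=
  let q : 'M[R]_(s.+1, N) := col_mx q0 y.1 in
  let P i := row i y.2 in
  let t i := time dt k + qpt S i * dt in
  dot p1 (row ord_max q)
  - dt * \sum_(i < r) alpha S i *
      (dot (P i) (dot_qd S dt k (t i) q) - H (qd S dt k (t i) q, P i))
  + dW * \sum_(i < r) beta S i * h (qd S dt k (t i) q, P i).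

Definition discrete_hamiltonian (R : realType) (N s r : nat)
    (S : galerkin R s r) (dt : R) (k : nat) (H h : 'rV[R]_N * 'rV[R]_N -> R)
    (dW : R) (q0 p1 : 'rV[R]_N) : R :=
  ext (discrete_functional S dt k H h dW q0 p1).

Definition next_position (R : realType) (N : nat)
    (Hd : 'rV[R]_N -> 'rV[R]_N -> R) (q0 p1 : 'rV[R]_N) : 'rV[R]_N :=
  grad (Hd q0) p1.

Definition discrete_lagrangian (R : realType) (N : nat)
    (Hd : 'rV[R]_N -> 'rV[R]_N -> R) (q0 p1 : 'rV[R]_N) : R :=
  dot p1 (next_position Hd q0 p1) - Hd q0 p1.

(* Main.v *)
From HB Require Import structures.
Require Import Defs.

(** Equivariance of the interpolation forces every [Phi g] to be affine.  Put
    all control values at 0 except the last one, equal to [x], and look at the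
    initial time of the step.  The interpolant is then at 0, with velocity
    proportional to [x]; the factor involves the derivative of the last Lagrange
    polynomial at the first control point, which is a simple root, so it is
    nonzero ([lagrange_poly_deriv_neq0]).  The velocity component of
    equivariance therefore says that the Jacobian matrix [M] of [Phi g] at 0
    sends [x] to [Phi g x - Phi g 0] ([equivariant_affine]).

    Consequently the cotangent lift is [(q, p) |-> (Phi g q, p *m K^T)], where
    [K] is the linear part of [Phi g^-1], so that [M *m K = 1%:M]: momenta are
    transformed by a matrix that does not depend on the base point.  Under the
    substitution q^mu |-> Phi g q^mu, P_i |-> P_i *m K^T, each pairing of P_i
    with a velocity and each value of [H] and [h] is preserved, and the boundary
    term changes by the pairing of [p *m K^T] with [Phi g 0], which does not
    depend on the control variables ([discrete_functional_equivariant]).  This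
    substitution is an affine automorphism of the space of control variables,
    hence it carries stationary points to stationary points ([ext_shift]) and
<<
    Hd (Phi g q0) (p *m K^T) = Hd q0 p + dot (p *m K^T) (Phi g 0).
>>
    Differentiating this identity in [p] shows that the next position is
    transformed by [Phi g]; the two occurrences of the pairing with [Phi g 0]
    then cancel in the discrete Lagrangian ([discrete_lagrangian_invariant]). *)

Set Implicit Arguments.
Unset Strict Implicit.
Unset Printing Implicit Defensive.

Import Order.TTheory GRing.Theory Num.Theory.

Local Open Scope classical_set_scope.
Local Open Scope ring_scope.

(** * Differential calculus on spaces of matrices *)

Lemma mx_linear_differentiable (R : realType) (m n : nat) (V : normedModType R)
    (f : {linear 'M[R]_(m, n) -> V}) (x : 'M[R]_(m, n)) : differentiable f x.
Proof.
have -> : (f : _ -> _) = \sum_(i < m) \sum_(j < n)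
    (fun y : 'M[R]_(m, n) => y i j *: f (delta_mx i j)).
  apply/funext => y; rewrite {1}(matrix_sum_delta y) !linear_sum fct_sumE.
  apply: eq_bigr => i _; rewrite linear_sum fct_sumE.
  by apply: eq_bigr => j _; rewrite linearZ.
do 2! (apply: differentiable_sum => ?).
exact/differentiableZl/differentiable_coord.
Qed.

Lemma derive_mx_linear (R : realType) (m n : nat) (V : normedModType R)
    (f : {linear 'M[R]_(m, n) -> V}) (x v : 'M[R]_(m, n)) : 'D_v f x = f v.
Proof.
rewrite deriveE; last exact: mx_linear_differentiable.
rewrite diff_lin// => y.
exact/differentiable_continuous/mx_linear_differentiable.
Qed.

Lemma differentiable_mulmxr (R : realType) (l m n : nat) (M : 'M[R]_(m, n))
    (x : 'M[R]_(l, m)) : differentiable (fun y : 'M[R]_(l, m) => y *m M) x.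
Proof. exact: (mx_linear_differentiable (mulmxr M)). Qed.

Lemma pderiv_affine (R : realType) (n : nat) (f : 'rV[R]_n -> 'rV[R]_n)
    (M : 'M[R]_n) (b : 'rV[R]_n) (i : 'I_n) (x : 'rV[R]_n) :
  (forall y, f y = y *m M + b) -> pderiv i f x = row i M.
Proof.
move=> fE; have -> : f = (fun y => y *m M) \+ cst b by exact/funext.
rewrite /pderiv deriveD; last 2 first.
- exact/diff_derivable/differentiable_mulmxr.
- exact: derivable_cst.
by rewrite derive_cst addr0 (derive_mx_linear (mulmxr M)) /= -rowE.
Qed.

(** * The pairing of covectors and vectors *)

Lemma dotE (R : realType) (n : nat) (u v : 'rV[R]_n) :
  dot u v = (u *m v^T) 0 0.
Proof. by rewrite mxE; apply: eq_bigr => i _; rewrite mxE. Qed.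

Lemma dotDr (R : realType) (n : nat) (u v w : 'rV[R]_n) :
  dot u (v + w) = dot u v + dot u w.
Proof. by rewrite !dotE linearD/= mulmxDr mxE. Qed.

Lemma dot_delta (R : realType) (n : nat) (i : 'I_n) (u : 'rV[R]_n) :
  dot (delta_mx 0 i) u = u 0 i.
Proof. by rewrite dotE -rowE !mxE. Qed.

(** Covectors transform contragrediently to vectors. *)
Lemma dot_mul_trmx (R : realType) (n : nat) (M K : 'M[R]_n) (u v : 'rV[R]_n) :
  M *m K = 1%:M -> dot (u *m K^T) (v *m M) = dot u v.
Proof.
move=> MK; rewrite !dotE trmx_mul mulmxA -(mulmxA u) -trmx_mul MK.
by rewrite trmx1 mulmx1.
Qed.

Lemma differentiable_dotl (R : realType) (n : nat) (u x : 'rV[R]_n) :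
  differentiable (fun p => dot p u) x.
Proof.
under eq_fun do rewrite dotE.
exact: (differentiable_comp (differentiable_mulmxr _ _)
         (differentiable_coord _ _ _)).
Qed.

Lemma grad_dotl (R : realType) (n : nat) (u x : 'rV[R]_n) :
  grad (fun p => dot p u) x = u.
Proof.
apply/rowP => i; rewrite mxE /pderiv.
have lin : linear (fun p : 'rV[R]_n => dot p u : R).
  by move=> a y z; rewrite !dotE mulmxDl -scalemxAl !mxE.
pose L := GRing.isLinear.Build _ _ _ _ _ lin.
pose f : {linear 'rV[R]_n -> R} := HB.pack (fun p : 'rV[R]_n => dot p u : R) L.
by rewrite (derive_mx_linear f) /= dot_delta.
Qed.

Lemma grad_mulmxr (R : realType) (n : nat) (f : 'rV[R]_n -> R) (A : 'M[R]_n)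
    (x : 'rV[R]_n) :
  differentiable f (x *m A) ->
  grad (fun p => f (p *m A)) x = grad f (x *m A) *m A^T.
Proof.
move=> df; apply/rowP => i; rewrite !mxE /pderiv.
have dA := differentiable_mulmxr A x.
rewrite deriveE; last exact: (differentiable_comp dA df).
have -> : (fun p => f (p *m A)) = f \o mulmxr A by [].
rewrite diff_comp//=.
have -> : 'd (mulmxr A) x (delta_mx 0 i) = row i A.
  by rewrite -deriveE// (derive_mx_linear (mulmxr A)) /= -rowE.
rewrite [X in 'd _ _ X]row_sum_delta linear_sum.
by apply: eq_bigr => j _; rewrite linearZ /= !mxE /pderiv deriveE// mulrC.
Qed.

(** * Stationary values *)

Lemma stationary_value_comp (R : realType) (V : normedModType R)
    (F F' : V -> R) (T T' : V -> V) (c v : R) :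
  (forall y, differentiable T y) -> cancel T' T ->
  (forall y, F y = F' (T y) + c) ->
  stationary_value F' v -> stationary_value F (v + c).
Proof.
move=> dT T'K FE [y' [dF' F'0 <-]].
have -> : F = (F' \o T) + cst c by exact/funext.
have dF : differentiable F' (T (T' y')) by rewrite T'K.
have dFT := differentiable_comp (dT (T' y')) dF.
exists (T' y'); split.
- exact: differentiableD.
- move=> u; rewrite diffD// diff_cst /= addr0 diff_comp//=.
  by rewrite T'K F'0.
- by rewrite /= [LHS]/(_ + _) /= T'K.
Qed.

(** Both directions of the correspondence between stationary points are needed:
    [T] transports existence of the stationary value, [T'] its uniqueness.
    Without [ext_defined F] the two sides may be unrelated unspecified values. *)
Lemma ext_shift (R : realType) (V : normedModType R)
    (F F' : V -> R) (T T' : V -> V) (c : R) :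
  (forall y, differentiable T y) -> (forall y, differentiable T' y) ->
  cancel T T' -> cancel T' T -> (forall y, F' (T y) = F y + c) ->
  ext_defined F -> ext F' = ext F + c.
Proof.
move=> dT dT' TK T'K F'E [v [vF vU]].
have F'T' y : F' y = F (T' y) + c by rewrite -F'E T'K.
have FT y : F y = F' (T y) - c by rewrite F'E addrK.
have -> : ext F = v.
  by apply: get_unique => //= u uF; apply/esym/vU.
apply: get_unique => /=; first exact: (stationary_value_comp dT' TK F'T' vF).
move=> u /(stationary_value_comp dT T'K FT)/vU ->; by rewrite subrK.
Qed.

(** * Equivariant interpolation forces an affine action *)

Lemma lagrange_poly_root (R : realType) (s r : nat) (S : galerkin R s r)
    (mu nu : 'I_s.+1) : nu != mu -> (lagrange_poly S mu).[cpt S nu] = 0.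
Proof.
move=> nm; rewrite /lagrange_poly horner_prod (bigD1 nu)//=.
by rewrite !hornerE subrr mulr0 mul0r.
Qed.

Lemma cpt_inj (R : realType) (s r : nat) (S : galerkin R s r) :
  injective (cpt S).
Proof.
move=> i j cij; apply/val_inj; case: (ltngtP i j) => // /(cpt_inc S).
  by rewrite cij ltxx.
by rewrite cij ltxx.
Qed.

(** The control points other than [mu] are simple roots of the Lagrange
    polynomial of [mu]. *)
Lemma lagrange_poly_deriv_neq0 (R : realType) (s r : nat) (S : galerkin R s r)
    (mu nu : 'I_s.+1) :
  nu != mu -> (lagrange_poly S mu)^`().[cpt S nu] != 0.
Proof.
move=> nm.
(* Only the derivative of the factor vanishing at [cpt S nu] contributes. *)
rewrite /lagrange_poly (bigD1 nu)//= derivM hornerD !hornerM.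
rewrite derivZ derivXsubC !hornerE subrr mulr0 mul0r addr0.
have cpt_neq (i j : 'I_s.+1) : i != j -> cpt S i - cpt S j != 0.
  by move=> ij; rewrite subr_eq0 (inj_eq (@cpt_inj _ _ _ S)).
apply: mulf_neq0; first by rewrite invr_neq0// cpt_neq// eq_sym.
rewrite horner_prod; apply/prodf_neq0 => i /andP[im inu].
by rewrite !hornerE mulf_neq0 ?invr_neq0 ?cpt_neq// eq_sym.
Qed.

(** The transposed Jacobian matrix of [f] at 0: vectors are rows, so the
    differential of [f] at 0, when it exists, is [x |-> x *m linear_part f]. *)
Definition linear_part (R : realType) (N : nat) (f : 'rV[R]_N -> 'rV[R]_N) :
    'M[R]_N :=
  \matrix_(j, i) pderiv j f 0 0 i.

(** [f] is an affine map; its linear part is then its differential at 0. *)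
Definition is_affine (R : realType) (N : nat) (f : 'rV[R]_N -> 'rV[R]_N) :
    Prop :=
  forall x, f x = x *m linear_part f + f 0.

(** The control values that all vanish, except the one of index [mu]. *)
Definition spike_rows (R : realType) (n N : nat) (mu : 'I_n) (x : 'rV[R]_N) :
    'M[R]_(n, N) :=
  \matrix_nu (if nu == mu then x else 0).

Lemma sum_spike_rows (R : realType) (n N : nat) (a : 'I_n -> R) (mu : 'I_n)
    (f : 'rV[R]_N -> 'rV[R]_N) (x : 'rV[R]_N) :
  \sum_nu a nu *: f (row nu (spike_rows mu x)) =
  a mu *: (f x - f 0) + \sum_nu a nu *: f 0.
Proof.
rewrite (bigD1 mu)//= [in RHS](bigD1 mu)//= rowK eqxx addrA scalerBr subrK.
congr (_ + _); apply: eq_bigr => nu /negbTE nm.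
by rewrite rowK nm.
Qed.

Lemma row_map_rows (R : realType) (n N : nat) (f : 'rV[R]_N -> 'rV[R]_N)
    (q : 'M[R]_(n.+1, N)) (mu : 'I_n.+1) : row mu (map_rows f q) = f (row mu q).
Proof. exact: rowK. Qed.

Lemma equivariant_affine (R : realType) (N s r : nat) (S : galerkin R s r)
    (dt : R) (k : nat) (G : groupType) (Phi : G -> 'rV[R]_N -> 'rV[R]_N) :
  (1 <= s)%N -> 0 < dt -> equivariant_interpolation S dt k Phi ->
  forall g, is_affine (Phi g).
Proof.
move=> s1 dt0 eqv g x.
have nm : (ord0 : 'I_s.+1) != ord_max by rewrite -val_eqE /= eq_sym -lt0n.
have [tk tkT] : time dt k <= time dt k <= time dt k.+1 /\
    (time dt k - time dt k) / dt = cpt S ord0.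
  split; last by rewrite subrr mul0r cpt0.
  by rewrite lexx /= /time ler_pM2r// ler_nat.
pose a nu := (lagrange_poly S nu)^`().[cpt S ord0].
have qd0 y : qd S dt k (time dt k) (spike_rows ord_max y) = 0.
  rewrite /qd tkT.
  rewrite (sum_spike_rows
    (fun nu => (lagrange_poly S nu).[cpt S ord0]) ord_max id).
  rewrite lagrange_poly_root// scale0r add0r.
  by apply: big1 => nu _; rewrite scaler0.
have dqd y : dot_qd S dt k (time dt k) (spike_rows ord_max y) =
    dt^-1 *: (a ord_max *: y).
  rewrite /dot_qd tkT (sum_spike_rows a ord_max id) subr0.
  by rewrite [X in _ + X]big1 ?addr0// => nu _; rewrite scaler0.
have dqdPhi y :
    dot_qd S dt k (time dt k) (map_rows (Phi g) (spike_rows ord_max y)) =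
    dt^-1 *: (a ord_max *: (Phi g y - Phi g 0) + \sum_nu a nu *: Phi g 0).
  rewrite /dot_qd tkT -sum_spike_rows; congr (_ *: _).
  by apply: eq_bigr => nu _; rewrite row_map_rows.
have eqvE y : dt^-1 *: (a ord_max *: (y *m linear_part (Phi g))) =
    dt^-1 *: (a ord_max *: (Phi g y - Phi g 0) + \sum_nu a nu *: Phi g 0).
  rewrite -dqdPhi; have := eqv g (spike_rows ord_max y) _ tk.
  rewrite /tangent_lift/= qd0 => -[_ <-]; rewrite dqd !scalemxAl.
  apply/rowP => i; rewrite !mxE; apply: eq_bigr => j _.
  by rewrite !mxE mulrC.
(* This also follows from the Lagrange polynomials summing up to 1, but the
   instance [y = 0] of [eqvE] gives it at once. *)
have sum0 : \sum_nu a nu *: Phi g 0 = 0.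
  have := eqvE 0; rewrite mul0mx !scaler0 subrr scaler0 add0r => /esym/eqP.
  by rewrite scaler_eq0 invr_eq0 gt_eqF//= => /eqP.
have := eqvE x; rewrite sum0 addr0.
move=> /(scalerI (invr_neq0 (lt0r_neq0 dt0))).
by move=> /(scalerI (lagrange_poly_deriv_neq0 S nm)) ->; rewrite subrK.
Qed.

(** * Tangent and cotangent lifts of an affine action *)

Lemma tangent_lift_affine (R : realType) (N : nat) (G : groupType)
    (Phi : G -> 'rV[R]_N -> 'rV[R]_N) (g : G) z :
  is_affine (Phi g) ->
  tangent_lift Phi g z = (Phi g z.1, z.2 *m linear_part (Phi g)).
Proof.
move=> af; rewrite /tangent_lift; congr pair; apply/rowP => i; rewrite !mxE.
by apply: eq_bigr => j _; rewrite (pderiv_affine _ _ af) mxE mulrC.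
Qed.

Lemma cotangent_lift_affine (R : realType) (N : nat) (G : groupType)
    (Phi : G -> 'rV[R]_N -> 'rV[R]_N) (g : G) z :
  is_affine (Phi (g^-1)%g) ->
  cotangent_lift Phi g z = (Phi g z.1, z.2 *m (linear_part (Phi (g^-1)%g))^T).
Proof.
move=> af; rewrite /cotangent_lift; congr pair; apply/rowP => i; rewrite !mxE.
by apply: eq_bigr => j _; rewrite (pderiv_affine _ _ af) !mxE.
Qed.

Lemma linear_part_cancel (R : realType) (N : nat)
    (f f' : 'rV[R]_N -> 'rV[R]_N) :
  is_affine f -> is_affine f' -> cancel f f' ->
  linear_part f *m linear_part f' = 1%:M.
Proof.
move=> af af' fK; apply/row_matrixP => i; rewrite !rowE mulmx1 mulmxA.
have f'B x y : f' x - f' y = (x - y) *m linear_part f'.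
  by rewrite af' [f' y]af' opprD addrACA subrr addr0 mulmxBl.
have -> : delta_mx 0 i *m linear_part f = f (delta_mx 0 i) - f 0.
  by rewrite af addrK.
by rewrite -f'B !fK subr0.
Qed.

(** * Equivariance of the discrete functional *)

(** The transformation of the control variables: [f] acts on the positions
    q^1, ..., q^s and [K^T] on the momenta P_1, ..., P_r. *)
Definition map_controls (R : realType) (s r N : nat) (f : 'rV[R]_N -> 'rV[R]_N)
    (K : 'M[R]_N) (y : 'M[R]_(s, N) * 'M[R]_(r, N)) :
    'M[R]_(s, N) * 'M[R]_(r, N) :=
  (\matrix_mu f (row mu y.1), y.2 *m K^T).

Lemma map_controlsK (R : realType) (s r N : nat) (f f' : 'rV[R]_N -> 'rV[R]_N)
    (K K' : 'M[R]_N) :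
  cancel f f' -> K' *m K = 1%:M ->
  cancel (@map_controls R s r N f K) (map_controls f' K').
Proof.
move=> fK KK' [q p]; rewrite /map_controls /=; congr pair.
  by apply/row_matrixP => i; rewrite !rowK fK.
by rewrite -mulmxA -trmx_mul KK' trmx1 mulmx1.
Qed.

Lemma map_controls_differentiable (R : realType) (s r N : nat)
    (f : 'rV[R]_N -> 'rV[R]_N) (K : 'M[R]_N) y :
  is_affine f -> differentiable (@map_controls R s r N f K) y.
Proof.
move=> af.
have -> : @map_controls R s r N f K = (fun y =>
    (y.1 *m linear_part f + \matrix_(mu < s) f 0, y.2 *m K^T)).
  apply/funext => z; congr pair; apply/row_matrixP => mu.
  by rewrite linearD /= row_mul !rowK af.
have d1 : differentiable (fun z : 'M[R]_(s, N) * 'M[R]_(r, N) => z.1) y.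
  by apply: (@linear_differentiable _ _ _ fst) => z; exact: cvg_fst.
have d2 : differentiable (fun z : 'M[R]_(s, N) * 'M[R]_(r, N) => z.2) y.
  by apply: (@linear_differentiable _ _ _ snd) => z; exact: cvg_snd.
apply: differentiable_pair.
- apply: differentiableD; last exact: differentiable_cst.
  exact: (differentiable_comp d1 (differentiable_mulmxr _ _)).
- exact: (differentiable_comp d2 (differentiable_mulmxr _ _)).
Qed.

Lemma map_rows_col_mx (R : realType) (s N : nat) (f : 'rV[R]_N -> 'rV[R]_N)
    (q0 : 'rV[R]_N) (q : 'M[R]_(s, N)) :
  map_rows f (col_mx q0 q : 'M[R]_(s.+1, N)) =
  (col_mx (f q0) (\matrix_mu f (row mu q)) : 'M[R]_(s.+1, N)).
Proof.
apply/row_matrixP => mu; rewrite row_map_rows.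
suff rowE (nu : 'I_(1 + s)) : f (row nu (col_mx q0 q)) =
  row nu (col_mx (f q0) (\matrix_i f (row i q))) by exact: rowE.
case: (split_ordP nu) => i ->; first by rewrite ord1 !rowKu !row_id.
by rewrite !rowKd rowK.
Qed.

Lemma discrete_functional_equivariant (R : realType) (N s r : nat)
    (S : galerkin R s r) (dt : R) (k : nat) (H h : 'rV[R]_N * 'rV[R]_N -> R)
    (dW : R) (G : groupType) (Phi : G -> 'rV[R]_N -> 'rV[R]_N) (g : G)
    (q0 p : 'rV[R]_N) y :
  let K := linear_part (Phi (g^-1)%g) in
  (forall g : G, is_affine (Phi g)) -> linear_part (Phi g) *m K = 1%:M ->
  0 < dt ->
  (forall z, H (cotangent_lift Phi g z) = H z) ->
  (forall z, h (cotangent_lift Phi g z) = h z) ->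
  equivariant_interpolation S dt k Phi ->
  discrete_functional S dt k H h dW (Phi g q0) (p *m K^T)
    (map_controls (Phi g) K y) =
  discrete_functional S dt k H h dW q0 p y + dot (p *m K^T) (Phi g 0).
Proof.
move=> K af MK dt0 Hg hg eqv.
rewrite /discrete_functional /= -map_rows_col_mx.
set q := (col_mx q0 y.1 : 'M[R]_(s.+1, N)).
pose t i := time dt k + qpt S i * dt.
have tP i : time dt k <= t i <= time dt k.+1.
  have c0 := qpt_ge0 S i; have c1 := qpt_le1 S i.
  rewrite /t lerDl mulr_ge0 ?(ltW dt0)//= /time -natr1 mulrDl lerD2l.
  by rewrite ler_pM2r.
have qdE i : qd S dt k (t i) (map_rows (Phi g) q) = Phi g (qd S dt k (t i) q).
  by have := eqv g q _ (tP i); rewrite tangent_lift_affine// => -[<-].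
have dqdE i : dot_qd S dt k (t i) (map_rows (Phi g) q) =
    dot_qd S dt k (t i) q *m linear_part (Phi g).
  by have := eqv g q _ (tP i); rewrite tangent_lift_affine// => -[_ <-].
have invE (E : 'rV[R]_N * 'rV[R]_N -> R) i :
    (forall z, E (cotangent_lift Phi g z) = E z) ->
    E (qd S dt k (t i) (map_rows (Phi g) q), row i (y.2 *m K^T)) =
    E (qd S dt k (t i) q, row i y.2).
  by move=> Eg; rewrite -[RHS]Eg cotangent_lift_affine//= qdE row_mul.
rewrite row_map_rows [Phi g (row _ _)]af dotDr dot_mul_trmx//.
under eq_bigr => i _.
  rewrite -/(t i) invE// dqdE row_mul dot_mul_trmx//; over.
under [in X in _ + X = _]eq_bigr => i _ do rewrite -/(t i) invE//.
by rewrite -!addrA; congr (_ + _); rewrite addrC -!addrA.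
Qed.

(** * Invariance of the discrete Lagrangian *)

(** The relation between the values of [Hd] is needed on a neighbourhood of [p1]
    since the next position is a derivative of [Hd]. *)
Lemma discrete_lagrangian_invariant (R : realType) (N : nat)
    (Hd : 'rV[R]_N -> 'rV[R]_N -> R) (f : 'rV[R]_N -> 'rV[R]_N) (K : 'M[R]_N)
    (q0 p1 : 'rV[R]_N) :
  is_affine f -> linear_part f *m K = 1%:M ->
  (\forall p \near p1, Hd (f q0) (p *m K^T) = Hd q0 p + dot (p *m K^T) (f 0)) ->
  differentiable (Hd q0) p1 ->
  discrete_lagrangian Hd (f q0) (p1 *m K^T) = discrete_lagrangian Hd q0 p1.
Proof.
move=> af MK HdE dHd; set M := linear_part f in MK *.
have KM : M^T *m K^T = 1%:M by rewrite -trmx_mul (mulmx1C MK) trmx1.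
have KM' : K^T *m M^T = 1%:M by rewrite -trmx_mul MK trmx1.
have p1E : p1 *m K^T *m M^T = p1 by rewrite -mulmxA KM' mulmx1.
have HdE' : \forall p \near p1 *m K^T,
    Hd (f q0) p = Hd q0 (p *m M^T) + dot p (f 0).
  have cM : (fun p => p *m M^T) @ (p1 *m K^T) --> p1 *m K^T *m M^T.
    exact: (differentiable_continuous (differentiable_mulmxr _ _)).
  rewrite p1E in cM.
  apply: (@filterS _ (nbhs (p1 *m K^T)) _ _ _ _ (cM _ HdE)) => p /=.
  by rewrite -mulmxA KM mulmx1.
have nextE : next_position Hd (f q0) (p1 *m K^T) = f (next_position Hd q0 p1).
  have dHdM : differentiable (Hd q0) (p1 *m K^T *m M^T) by rewrite p1E.
  have := grad_mulmxr dHdM; rewrite trmxK p1E => gradE.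
  rewrite [RHS]af /next_position -/M -gradE.
  rewrite -[X in _ + X](grad_dotl (f 0) (p1 *m K^T)).
  apply/rowP => i; rewrite !mxE /pderiv (near_eq_derive _ HdE') deriveD//.
  - apply: diff_derivable.
    exact: (differentiable_comp (differentiable_mulmxr _ _) dHdM).
  - exact/diff_derivable/differentiable_dotl.
rewrite /discrete_lagrangian nextE (nbhs_singleton HdE).
rewrite [f (next_position _ _ _)]af.
by rewrite dotDr dot_mul_trmx// opprD addrACA subrr addr0.
Qed.

Theorem theorem3p3 (R : realType) (N m s r : nat)
  (d : measure_display) (Omega : measurableType d) (P : probability Omega R)
  (F : R -> set (set Omega)) (hF : is_filtration F)
  (W : R -> Omega -> R) (hW : is_wiener P F W)
  (H h : 'rV[R]_N * 'rV[R]_N -> R)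
  (hH2 : Ck_on 2 setT H) (hh2 : Ck_on 2 setT h)
  (hA : lipschitz (ito_drift H h)) (hB : lipschitz (ito_diffusion h))
  (G : groupTopologicalType) (atlas : set (chart R m G))
  (hG : is_lie_group atlas)
  (Phi : G -> 'rV[R]_N -> 'rV[R]_N) (hPhi : is_lie_left_action atlas Phi)
  (hs : (1 <= s)%N) (S : galerkin R s r) (dt : R) (hdt : 0 < dt) (k : nat)
  (hHinv : forall (g : G) z, H (cotangent_lift Phi g z) = H z)
  (hhinv : forall (g : G) z, h (cotangent_lift Phi g z) = h z)
  (heq : equivariant_interpolation S dt k Phi)
  (w : Omega) (qk pk1 : 'rV[R]_N) :
  let dW := increment W dt k w in
  let Hd := discrete_hamiltonian S dt k H h dW in
  let Rd := discrete_lagrangian Hd in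
  let qk1 := next_position Hd qk pk1 in
  (* H_d^+ is well defined around (q_k, p_{k+1}), and D_2 H_d^+ exists there *)
  (\forall p \near pk1, ext_defined (discrete_functional S dt k H h dW qk p)) ->
  differentiable (Hd qk) pk1 ->
  forall g : G, Rd (Phi g qk) (cotangent_lift Phi g (qk1, pk1)).2 = Rd qk pk1.
Proof.
move=> dW Hd Rd qk1 ext_qk dHd g.
have af := equivariant_affine hs hdt heq.
have PhiK g' : cancel (Phi g') (Phi (g'^-1)%g).
  by move=> q; rewrite -(actM hPhi) mulVg (act1 hPhi).
have PhiVK : cancel (Phi (g^-1)%g) (Phi g).
  by move=> q; rewrite -(actM hPhi) mulgV (act1 hPhi).
have MK := linear_part_cancel (af g) (af (g^-1)%g) (PhiK g).
rewrite cotangent_lift_affine//=.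
apply: discrete_lagrangian_invariant => //.
apply: filterS ext_qk => p ext_p.
apply: (ext_shift (T := map_controls (Phi g) (linear_part (Phi (g^-1)%g)))
  (T' := map_controls (Phi (g^-1)%g) (linear_part (Phi g)))) ext_p.
- by move=> y; exact: map_controls_differentiable.
- by move=> y; exact: map_controls_differentiable.
- exact: map_controlsK.
- exact: map_controlsK (mulmx1C MK).
- by move=> y; exact: discrete_functional_equivariant.
Qed.
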